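(* Let $n,q\ge1$ and $0<r<n$ be integers and $m=qn+r$. Let $a_1,\dots,a_n\in\mathbb{C}$ with $a_n=1$, $b_0,\dots,b_m\in\mathbb{C}$ with $b_m\ne0$, and consider the Airy operator $\mathcal{L}=\sum_{i=1}^{n}a_i\left(\frac{d}{dx}\right)^i-\sum_{j=0}^{m}b_jx^j$. Put $z=1/x$. Then the determining factors of $\mathcal{L}$ at $z=0$ (i.e. at $x=\infty$) are given by $$Q(z)=\frac{-1}{z^{1+\frac mn}}\left[\frac{1}{1+\frac mn}\alpha_0+\frac nm\alpha_nz+\dots+\frac{n}{n+r}\alpha_{qn}z^q+\alpha_mz^{\frac mn}+\frac nr\alpha_{(q+1)n}z^{q+1}\right],$$ that is, $Q(z)=-z^{-1-\frac mn}\left[\sum_{s=0}^{q+1}\frac{n}{n+m-sn}\alpha_{sn}z^s+\alpha_mz^{\frac mn}\right]$, where $(\alpha_0,\alpha_n,\dots,\alpha_{qn},\alpha_m,\alpha_{(q+1)n})$ is a solution of the system $$(\mathcal{B})\quad\begin{cases}\beta_{sn,n}=(-1)^nb_{m-s}, & 0\le s\le q+1,\\ \beta_{m,n}=a_{n-1}\beta_{0,n-1},\end{cases}$$ and the determining factors depend only on $a_{n-1}$ and $b_{m-s}$ $(0\le s\le q+1)$.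
   Context: For given $\alpha_0,\alpha_n,\dots,\alpha_{qn},\alpha_m,\alpha_{(q+1)n}\in\mathbb{C}$, set $\alpha_j=0$ for all other indices $0<j<m+n$. For integers $k\ge1$ and $0\le j<m+n$, $\beta_{j,k}$ is the coefficient of $t^j$ in $\left(\sum_{i=0}^{m+n-1}\alpha_it^i\right)^k$ (so $\beta_{j,1}=\alpha_j$, $\beta_{0,k}=\alpha_0^k$, $\beta_{j,k+1}=\sum_{s=0}^{j}\alpha_s\beta_{j-s,k}$). Determining factors: by the Hukuhara–Turrittin theorem, the equation $\mathcal{L}(u)=0$, rewritten in the variable $z=1/x$, has a basis of $n$ formal solutions near $z=0$ of the form $u_i(z)=e^{Q_i(z)}z^{\lambda_i}v_i(z)$, where $Q_i$ is a polynomial in $z^{-1/e}$ without constant term ($e$ a positive integer), $\lambda_i\in\mathbb{C}$, and $v_i$ is a polynomial in $\log z$ with coefficients formal power series in $z^{1/e}$. The $Q_i$ are the determining factors. *)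

(* Defs.v *)
From mathcomp Require Export all_boot all_order all_algebra.
From mathcomp Require Export finmap reals complex monalg.

Set Implicit Arguments.
Unset Strict Implicit.
Unset Printing Implicit Defensive.

Import Order.TTheory GRing.Theory Num.Theory.
Local Open Scope ring_scope.

(* A finite sum \sum_rho Q_rho z^rho with rational exponents is an element
   Q of {malg C[rat]}, with Q@_rho the coefficient of z^rho. *)
Definition puiseux (C : numClosedFieldType) := {malg C[rat]}.

(* Polynomials in z^(-1/e) without constant term. *)
Definition exp_factor (C : numClosedFieldType) (e : nat) (Q : puiseux C) : Prop :=
  exists p : {poly C}, p`_0 = 0 /\
    Q = \sum_(j < size p) << p`_j *g - (j%:R / e%:R) >>.

(* F Q mu k is the coefficient of e^Q z^mu (log z)^k.  These monomials are
   linearly independent over C in the universal ring of formal solutions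
   (subject only to z^mu z^1 = z^(mu+1)), so expressions in them can be compared
   coefficientwise.  The operations below are meaningful for every F; the
   genuine formal expressions are singled out by ht_expr and ht_sum. *)
Definition formal (C : numClosedFieldType) := puiseux C -> C -> nat -> C.

Section FormalSolutions.
Variable C : numClosedFieldType.
Implicit Types (F : formal C) (Q : puiseux C) (mu lambda : C) (k n m : nat).

(* d(e^Q z^mu (log z)^k)/dz
     = \sum_rho rho Q_rho e^Q z^(mu + rho - 1) (log z)^k
       + mu e^Q z^(mu - 1) (log z)^k + k e^Q z^(mu - 1) (log z)^(k - 1). *)
Definition ddz F : formal C := fun Q mu k =>
  \sum_(rho <- msupp Q) ratr rho * Q@_rho * F Q (mu - (ratr rho - 1)) k
  + (mu + 1) * F Q (mu + 1) k
  + k.+1%:R * F Q (mu + 1) k.+1.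

(* d/dx = - z^2 d/dz and multiplication by x = z^(-1). *)
Definition ddx F : formal C := fun Q mu k => - ddz F Q (mu - 2) k.
Definition mulx F : formal C := fun Q mu k => F Q (mu + 1) k.

Definition airy_op n m (a b : nat -> C) F : formal C := fun Q mu k =>
  \sum_(1 <= i < n.+1) a i * iter i ddx F Q mu k
  - \sum_(0 <= j < m.+1) b j * iter j mulx F Q mu k.

Definition airy_sol n m (a b : nat -> C) F : Prop :=
  forall Q mu k, airy_op n m a b F Q mu k = 0.

(* F = e^Q z^lambda v, where v = \sum_k v_k(z) (log z)^k has finitely many terms
   and v_k(z) = \sum_(j >= 0) v_k(j) z^(j/e). *)
Definition ht_expr (e : nat) Q F : Prop :=
  [/\ (0 < e)%N, exp_factor e Q &
   exists (lambda : C) (v : seq (nat -> C)),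
     (forall k j, F Q (lambda + j%:R / e%:R) k = nth (fun=> 0) v k j) /\
     (forall Q' mu k,
        Q' <> Q \/ (forall j : nat, mu <> lambda + j%:R / e%:R) ->
        F Q' mu k = 0)].

Definition ht_sum F : Prop :=
  exists (N : nat) (f : 'I_N -> formal C),
    (forall i, exists (e : nat) Q, ht_expr e Q (f i)) /\
    (forall Q mu k, F Q mu k = \sum_i f i Q mu k).

(* (u_1, ..., u_n) is a C-basis of the space of formal solutions and
   u_i = e^(Q_i) z^(lambda_i) v_i. *)
Definition ht_basis n m (a b : nat -> C)
    (Qs : 'I_n -> puiseux C) (u : 'I_n -> formal C) : Prop :=
  [/\ exists e : nat, forall i, ht_expr e (Qs i) (u i),
      forall i, airy_sol n m a b (u i),
      forall c : 'I_n -> C,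
        (forall Q mu k, \sum_i c i * u i Q mu k = 0) -> forall i, c i = 0 &
      forall F, ht_sum F -> airy_sol n m a b F ->
        exists c : 'I_n -> C, forall Q mu k, F Q mu k = \sum_i c i * u i Q mu k].

Definition determining_factors n m (a b : nat -> C) (Qs : 'I_n -> puiseux C) :
    Prop :=
  exists u : 'I_n -> formal C, ht_basis m a b Qs u.

End FormalSolutions.

Section SystemB.
Variable C : numClosedFieldType.
Implicit Types (alpha a b : nat -> C) (n q m : nat).

Definition beta n m alpha (j k : nat) : C :=
  ((\poly_(i < m + n) alpha i) ^+ k)`_j.

Definition alpha_support n q m alpha : Prop :=
  forall j : nat, (0 < j < m + n)%N ->
    j \notin m :: [seq (s * n)%N | s <- iota 0 q.+2] -> alpha j = 0.

Definition system_B n q m a b alpha : Prop :=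
  (forall s : nat, (s <= q.+1)%N ->
     beta n m alpha (s * n) n = (-1) ^+ n * b (m - s)%N) /\
  beta n m alpha m n = a n.-1 * beta n m alpha 0 n.-1.

Definition airy_Q n q m alpha : puiseux C :=
  - (\sum_(s < q.+2)
        << n%:R / (n%:R + m%:R - (s * n)%:R) * alpha (s * n)%N
           *g - (1 + m%:R / n%:R) + s%:R >>
     + << alpha m *g - (1 + m%:R / n%:R) + m%:R / n%:R >>).

End SystemB.

(* Main.v *)
Require Import Defs.
From mathcomp Require Import ring zify boolp separable.
Set Implicit Arguments.
Unset Strict Implicit.
Unset Printing Implicit Defensive.
Import Order.TTheory GRing.Theory Num.Theory.
Local Open Scope ring_scope.

(** Fix a possible exponential factor Q and write a formal solution as e^Q G.
Let E = n e be a common denominator of the exponents, h = 1/E and t = z^h.  The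
function -z^2 Q' equals t^-M W(t) for a polynomial W, so on G the operator d/dx
becomes multiplication by t^-M W plus D = -z^2 d/dz.  The derivation D raises
exponents of t by E, while the multiplication lowers them by at most M.  Expanding the i-th powers, t^(Mn) L
acts on G as the polynomial S = symbol W, obtained from L by treating d/dx as
the commuting variable t^-M W, plus a remainder that raises exponents by at
least M + E (remainder_lead, airyQ_expand).  Only two things can happen.

- S has a nonzero coefficient below t^(M+E).  The lowest one multiplies the
  leading term of G, so no nonzero solution has the factor e^Q
  (symbol_obstruction).

- S vanishes modulo t^(M+E).  The coefficient of order M + E then gives an
  indicial equation of degree one, whose root rho is the only possible leading
  exponent, with no logarithm.  Solutions are therefore unique up to a scalar
  (solutions_proportional), and one exists because the recursion for the
  coefficients of exponent rho + j h is solvable for all j > 0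
  (series_at_sol).

The second case forces M = m e and says that W is, modulo t^(M+E), a root of
W^n + a_(n-1) t^(me) W^(n-1) = sum_j b_j t^((m-j)E); the terms in a_i with
i <= n - 2 have order at least 2me, which is too high to matter.  Such a
truncated root is determined by W(0), an n-th root of b_m
(truncated_root_uniq).  For e = 1, putting W = -(alpha_0 + alpha_1 t + ...), the
polynomials A = -W that are supported on the multiples of n and on m solve this
congruence exactly when system (B) holds, and (B) is solvable for every n-th
root alpha_0 of (-1)^n b_m (system_B_exists).  Hence every admissible W comes
from (B), there are exactly n admissible factors, and each carries a
one-dimensional space of solutions.  It follows that a family Q_1, ..., Q_n
consists of the determining factors iff it enumerates the solutions of (B)
without repetition (determining_factorsE); this criterion mentions only a_(n-1)
and the b_(m-s) with s <= q + 1. *)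

(** * Roots of power series modulo a power of the variable *)

Section TruncatedRoots.
Variable C : numClosedFieldType.
Implicit Types (A B P Y : {poly C}) (c y : C) (n m N k : nat).

Lemma dvdXnP N P : reflect (forall h, (h < N)%N -> P`_h = 0) ('X^N %| P).
Proof.
apply: (iffP (dvdpP _ _)) => [[Q ->] h hN|P0]; first by rewrite coefMXn hN.
exists (drop_poly N P); rewrite -{1}(poly_take_drop N P).
suff -> : take_poly N P = 0 by rewrite add0r.
by apply/polyP => i; rewrite coef_take_poly coef0; case: ifP => // /P0.
Qed.

Lemma coef0_exp P k : (P ^+ k)`_0 = P`_0 ^+ k.
Proof. by rewrite -!horner_coef0 horner_exp. Qed.

Lemma coef0_geometric A B n : A`_0 = B`_0 ->
  (\sum_(i < n) A ^+ (n.-1 - i) * B ^+ i)`_0 = n%:R * A`_0 ^+ n.-1.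
Proof.
move=> eAB; rewrite coef_sum (eq_bigr (fun=> A`_0 ^+ n.-1)).
  by rewrite sumr_const card_ord mulr_natl.
move=> i _; rewrite coef0M !coef0_exp -eAB -exprD subnK //.
by case: n i => [[]|n i] //=; rewrite -ltnS.
Qed.

(** The difference of the two sides factors as A - B times a polynomial whose
constant coefficient is n A(0)^(n-1), hence prime to 'X. *)
Lemma truncated_root_uniq A B c n m N : (0 < n)%N -> (0 < m)%N ->
    A`_0 = B`_0 -> A`_0 != 0 ->
    'X^N %| (A ^+ n + c *: ('X^m * A ^+ n.-1))
            - (B ^+ n + c *: ('X^m * B ^+ n.-1)) ->
  'X^N %| A - B.
Proof.
move=> n0 m0 eAB A0 dvd; pose s k := \sum_(i < k) A ^+ (k.-1 - i) * B ^+ i.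
have facE : (A ^+ n + c *: ('X^m * A ^+ n.-1)) - (B ^+ n + c *: ('X^m * B ^+ n.-1))
    = (A - B) * (s n + c *: ('X^m * s n.-1)).
  rewrite mulrDr -scalerAr mulrCA -!subrXX.
  by rewrite mulrBr scalerBr opprD addrACA.
have U0 : (s n + c *: ('X^m * s n.-1))`_0 != 0.
  rewrite coefD coefZ coefXnM m0 mulr0 addr0 coef0_geometric //.
  by rewrite mulf_neq0 ?expf_neq0 // pnatr_eq0 -lt0n.
move: dvd; rewrite facE Gauss_dvdpl //.
rewrite coprimep_expl // coprimep_sym.
have := coprimep_XsubC (s n + c *: ('X^m * s n.-1)) 0.
by rewrite polyC0 subr0 rootE horner_coef0 => ->.
Qed.

(** Hensel lifting: adding c 'X^N to Y changes the coefficient of order N of Y^n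
by n y^(n-1) c, and y is invertible. *)
Lemma truncated_root_exists B y n N : (0 < n)%N -> y != 0 -> y ^+ n = B`_0 ->
  exists2 Y : {poly C}, Y`_0 = y & 'X^N %| Y ^+ n - B.
Proof.
move=> n0 y0 yB; elim: N => [|N [Y Y0 /dvdpP[R YR]]].
  by exists y%:P; rewrite ?coefC // expr0 dvd1p.
case: N => [|N] in YR *.
  exists y%:P; rewrite ?coefC //; apply/dvdXnP => -[|h] // _.
  by rewrite coefB coef0_exp coefC yB subrr.
pose c := - R`_0 / (n%:R * y ^+ n.-1); exists (Y + c *: 'X^(N.+1)).
  by rewrite coefD coefZ coefXn mulr0 addr0.
have -> : (Y + c *: 'X^(N.+1)) ^+ n - B =
    (R + c *: \sum_(i < n) (Y + c *: 'X^(N.+1)) ^+ (n.-1 - i) * Y ^+ i) * 'X^(N.+1).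
  rewrite -(subrKA (Y ^+ n)) subrXX addrAC subrr add0r addrC YR mulrDl.
  by rewrite -!scalerAl [X in _ + _ *: X]mulrC.
rewrite [in X in X %| _]exprS dvdp_mul //; apply/(dvdXnP 1) => -[|//] _.
rewrite coefD coefZ coef0_geometric; last first.
  by rewrite coefD coefZ coefXn mulr0 addr0.
rewrite coefD coefZ coefXn mulr0 addr0 Y0 /c mulfVK ?subrr //.
by rewrite mulf_neq0 ?expf_neq0 // pnatr_eq0 -lt0n.
Qed.

End TruncatedRoots.

(** * The symbol of the operator and system (B) *)

Section Symbol.
Variables (C : numClosedFieldType) (n q r m : nat) (a b : nat -> C).
Implicit Types (A B P W Y : {poly C}) (c : C) (alpha : nat -> C) (N k e M s : nat).

(** This is t^(Mn) times the operator with d/dx replaced by t^-M W and x by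
t^-(ne), where t = z^(1/(ne)). *)
Definition symbol e M W : {poly C} :=
  \sum_(1 <= i < n.+1) a i *: ('X^(M * (n - i)) * W ^+ i)
  - \sum_(0 <= j < m.+1) b j *: 'X^(M * n - j * (n * e)).

(** First-order Taylor expansion of the k-th power: the quadratic terms are
divisible by 'X^(2m), and P may be replaced by its constant coefficient in the
linear term. *)
Lemma dvdXn_exp_addXn P c k : (n <= m)%N -> 'X^n %| P - (P`_0)%:P ->
  'X^(m + n) %| (P + c *: 'X^m) ^+ k
                - (P ^+ k + (k%:R * c * P`_0 ^+ k.-1) *: 'X^m).
Proof.
move=> nm dP; elim: k => [|k IHk].
  by rewrite !expr0 !mul0r scale0r addr0 subrr dvdp0.
have dPk : 'X^n %| P ^+ k - (P`_0 ^+ k)%:P.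
  by rewrite rmorphXn subrXX dvdp_mulr.
have -> : (P + c *: 'X^m) ^+ k.+1
    - (P ^+ k.+1 + (k.+1%:R * c * P`_0 ^+ k) *: 'X^m) =
    (P + c *: 'X^m) * ((P + c *: 'X^m) ^+ k
                - (P ^+ k + (k%:R * c * P`_0 ^+ k.-1) *: 'X^m))
    + 'X^m * ((k%:R * c * P`_0 ^+ k.-1)%:P * (P - (P`_0)%:P)
              + c%:P * (P ^+ k - (P`_0 ^+ k)%:P))
    + (k%:R * c ^+ 2 * P`_0 ^+ k.-1)%:P * ('X^m * 'X^m).
  rewrite !exprS -!mul_polyC.
  have -> : (k.+1%:R * c * P`_0 ^+ k)%:P =
      (c * P`_0 ^+ k)%:P + (k%:R * c * P`_0 ^+ k.-1)%:P * (P`_0)%:P.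
    case: (k) => [|j]; rewrite -!rmorphM -!rmorphD /=; congr _%:P; first by ring.
    by rewrite exprS; ring.
  by rewrite !rmorphM /=; ring.
have dvd_mm : 'X^(m + n) %| 'X^m * ('X^m : {poly C}).
  by rewrite -exprD dvdp_exp2l // leq_add2l.
apply: dvdp_add; [apply: dvdp_add|]; [exact: dvdp_mull| |exact: dvdp_mull].
by rewrite exprD dvdp_mul // dvdp_add ?dvdp_mull.
Qed.

Lemma dvdXn_comp_subC Y N : (0 < N)%N ->
  'X^N %| (Y \Po 'X^N) - ((Y \Po 'X^N)`_0)%:P.
Proof.
move=> N0; apply/dvdXnP => -[|h] hN; rewrite coefB coefC ?subrr // subr0.
by rewrite coef_comp_poly_Xn // gtnNdvd.
Qed.

(** Refining the exponents from 1/n to 1/(ne) amounts to substituting t^e for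
t. *)
Lemma symbol_comp_Xn e W : (0 < e)%N ->
  symbol e (m * e) (W \Po 'X^e) = symbol 1 m W \Po 'X^e.
Proof.
move=> e0; rewrite /symbol raddfB /= !raddf_sum /=; congr (_ + _).
  apply: eq_bigr => i _; rewrite linearZ /= rmorphM /= !rmorphXn /= comp_polyX.
  by rewrite -exprM mulnAC mulnC.
apply: eq_bigr => j _; congr (- _); rewrite linearZ /= rmorphXn /= comp_polyX -exprM.
by rewrite mulnBr; congr (_ *: 'X^(_ - _)); nia.
Qed.

Section Support.
Hypotheses (hn : (1 <= n)%N) (hq : (1 <= q)%N) (hr : (0 < r < n)%N)
  (hm : m = (q * n + r)%N).

Let nm : (n <= m)%N. Proof. by rewrite hm; nia. Qed.
Let n_gt1 : (1 < n)%N. Proof. by lia. Qed.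
Let ndvd_m : (n %| m)%N = false.
Proof. by rewrite hm dvdn_addr ?dvdn_mull // gtnNdvd; case/andP: hr. Qed.

Definition multiples_part alpha : {poly C} := \poly_(s < q.+2) alpha (s * n)%N.

(** In degrees below m + n the multiples of n are s n with s <= q + 1, and m is
not among them. *)
Lemma support_decomposition alpha : alpha_support n q m alpha ->
  \poly_(i < m + n) alpha i = (multiples_part alpha \Po 'X^n) + alpha m *: 'X^m.
Proof.
move=> supp; apply/polyP=> i.
rewrite coefD coefZ coefXn coef_comp_poly_Xn ?coef_poly //.
have [/dvdnP[s ->]|ndvd] := boolP (n %| i)%N.
  have -> : (s * n == m)%N = false.
    by apply: contraFF ndvd_m => /eqP <-; rewrite dvdn_mull.
  rewrite mulnK // mulr0 addr0.
  by have -> : (s * n < m + n)%N = (s < q.+2)%N by rewrite hm; nia.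
rewrite add0r; have [->|im] := eqVneq i m.
  by rewrite -[ltnLHS]addn0 ltn_add2l hn mulr1.
rewrite mulr0; case: ifP => // i_lt; apply: supp.
  by rewrite i_lt andbT lt0n; apply: contra ndvd => /eqP->.
rewrite inE negb_or im andTb; apply: contra ndvd => /seq.mapP[s _ ->].
exact: dvdn_mull.
Qed.

Lemma sn_neq_m s : (s * n == m)%N = false.
Proof. by apply: contraFF ndvd_m => /eqP <-; rewrite dvdn_mull. Qed.

(** In degrees below m + n the coefficient alpha_m is used at most once, and only
in degree m; all other factors have degrees multiple of n.  This decouples
the two equations of the system. *)
Lemma beta_coef alpha : alpha_support n q m alpha -> forall k h,
    (h < m + n)%N -> beta n m alpha h k =
    (if (n %| h)%N then (multiples_part alpha ^+ k)`_(h %/ n) else 0)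
    + k%:R * alpha m * alpha 0%N ^+ k.-1 * (h == m)%:R.
Proof.
move=> supp k h h_lt; set Y := multiples_part alpha.
have Y0 : (Y \Po 'X^n)`_0 = alpha 0%N.
  by rewrite coef_comp_poly_Xn // dvdn0 div0n coef_poly.
rewrite /beta support_decomposition // -/Y.
have /dvdXnP/(_ h h_lt)/eqP := dvdXn_exp_addXn (alpha m) k nm (dvdXn_comp_subC Y hn).
rewrite coefB subr_eq0 => /eqP ->; rewrite coefD coefZ coefXn Y0.
by rewrite -rmorphXn /= coef_comp_poly_Xn.
Qed.

Lemma system_B_multiples_part alpha : alpha_support n q m alpha ->
  system_B n q m a b alpha <->
  (forall s, (s <= q.+1)%N ->
     (multiples_part alpha ^+ n)`_s = (-1) ^+ n * b (m - s)%N) /\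
  n%:R * alpha m * alpha 0%N ^+ n.-1 = a n.-1 * alpha 0%N ^+ n.-1.
Proof.
move=> supp; set Y := multiples_part alpha.
have betaE := beta_coef supp; rewrite -/Y in betaE.
have sn_lt s : (s <= q.+1)%N -> (s * n < m + n)%N by rewrite hm; nia.
rewrite /system_B; have -> : beta n m alpha m n = n%:R * alpha m * alpha 0%N ^+ n.-1.
  by rewrite betaE ?ndvd_m ?eqxx ?mulr1 ?add0r //; lia.
have -> : beta n m alpha 0 n.-1 = alpha 0%N ^+ n.-1.
  by rewrite /beta coef0_exp coef_poly; case: ifP => //; lia.
have bE s : (s <= q.+1)%N -> beta n m alpha (s * n) n = (Y ^+ n)`_s.
  by move=> hs; rewrite betaE ?sn_lt // dvdn_mull // mulnK // sn_neq_m mulr0 addr0.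
split=> -[h1 h2]; split=> // s hs; first by rewrite -bE ?h1.
by rewrite bE ?h1.
Qed.

(** The equations in b ask for an n-th root of a truncated series in t^n; the
equation in a_(n-1) is linear in alpha_m. *)
Lemma system_B_exists y : b m != 0 -> y ^+ n = (-1) ^+ n * b m ->
  exists alpha, [/\ alpha_support n q m alpha, system_B n q m a b alpha
                  & alpha 0%N = y].
Proof.
move=> bm yn; have y0 : y != 0.
  apply: contra_eq_neq yn => ->; rewrite expr0n gtn_eqF // eq_sym.
  by rewrite mulf_neq0 ?signr_eq0.
pose B := \poly_(s < q.+2) ((-1) ^+ n * b (m - s)%N).
have [|Y Y0 dY] := @truncated_root_exists _ B y n q.+2 hn y0.
  by rewrite coef_poly subn0.
pose alpha i := if (i == m)%N then a n.-1 / n%:R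
  else if (n %| i)%N && (i < m + n)%N then Y`_(i %/ n) else 0.
have alpha0 : alpha 0%N = y.
  by rewrite /alpha -[X in X == m](mul0n n) sn_neq_m dvdn0 addn_gt0 hn orbT div0n.
have supp : alpha_support n q m alpha.
  move=> j /andP[j0 j_lt]; rewrite inE negb_or /alpha => /andP[/negPf-> jn].
  case: ifP => // /andP[/dvdnP[s js] _]; case/negP: jn; rewrite js.
  by apply/seq.mapP; exists s => //; rewrite mem_iota js hm in j_lt *; nia.
exists alpha; split=> //; apply/system_B_multiples_part => //.
have n_neq0 : n%:R != 0 :> C by rewrite pnatr_eq0 -lt0n.
split=> [s hs|]; last by rewrite alpha0 /alpha eqxx [n%:R * _]mulrC mulfVK.
have /dvdXnP/(_ s hs)/eqP := dY.
rewrite coefB [B`_s]coef_poly ltnS hs subr_eq0 => /eqP <-.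
have tE : multiples_part alpha = take_poly q.+2 Y.
  apply/polyP=> i; rewrite coef_poly coef_take_poly /alpha sn_neq_m dvdn_mull //.
  case: ifP => // iq; have -> : (i * n < m + n)%N by rewrite hm; nia.
  by rewrite mulnK.
have : 'X^(q.+2) %| take_poly q.+2 Y ^+ n - Y ^+ n.
  rewrite subrXX dvdp_mulr //; apply/dvdXnP => h hq2.
  by rewrite coefB coef_take_poly hq2 subrr.
by move=> /dvdXnP/(_ s hs)/eqP; rewrite coefB subr_eq0 tE => /eqP.
Qed.

(** The terms of index i <= n - 2 carry a factor t^(2me) at least, and
n <= m. *)
Lemma symbol_congr e W : (0 < e)%N -> a n = 1 ->
  'X^(m * e + n * e) %| symbol e (m * e) W
     - (W ^+ n + a n.-1 *: ('X^(m * e) * W ^+ n.-1)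
        - \sum_(0 <= j < m.+1) b j *: 'X^(m * e * n - j * (n * e))).
Proof.
move=> e0 an; rewrite /symbol opprB addrA subrK.
have -> F : \sum_(1 <= i < n.+1) F i =
    \sum_(1 <= i < n.-1) F i + F n.-1 + F n :> {poly C}.
  have nE : n = n.-1.+1 by lia.
  by rewrite [in LHS]nE !big_nat_recr -?nE //=; lia.
rewrite subnn muln0 expr0 mul1r an scale1r.
have -> : (n - n.-1 = 1)%N by lia.
rewrite muln1 [W ^+ n + _]addrC -[X in X - _]addrA addrK.
rewrite big_nat; apply: (big_ind (dvdp _)) => [|x y|i]; [exact: dvdp0|exact: dvdp_add|].
rewrite -mul_polyC => /andP[i0 i_lt]; apply: dvdp_mull.
apply: dvdp_mulr; apply: dvdp_exp2l.
rewrite -mulnDl -mulnA [(e * _)%N]mulnC mulnA leq_mul2r.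
by apply/orP; right; rewrite (@leq_trans (m * 2)) ?leq_mul2l; lia.
Qed.

Lemma symbol_system_B alpha : a n = 1 ->
  alpha_support n q m alpha -> system_B n q m a b alpha ->
  'X^(m + n) %| symbol 1 m (- \poly_(i < m + n) alpha i).
Proof.
move=> an supp sysB; set A := \poly_(i < _) _.
have := symbol_congr (- A) (ltn0Sn 0) an; rewrite !muln1 => dS.
rewrite -(dvdp_addr _ (dvdp_mull (-1) dS)) mulN1r addrC subKr.
apply/dvdXnP => h h_lt.
have [h1 h2] := (system_B_multiples_part supp).1 sysB.
have low k j : (j < n)%N -> ((- A) ^+ k)`_j = (- alpha 0%N) ^+ k * (j == 0)%:R.
  move=> jn; rewrite -scaleN1r exprZn coefZ -[(A ^+ k)`_j]/(beta n m alpha j k).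
  rewrite (beta_coef supp) ?(ltn_addl _ jn) // (ltn_eqF (leq_trans jn nm)) mulr0 addr0.
  case: j jn => [|j] jn; last by rewrite gtnNdvd ?mulr0.
  by rewrite dvdn0 div0n coef0_exp coef_poly mulr1 -exprMn mulN1r.
have bE : (\sum_(0 <= j < m.+1) b j *: 'X^(m * n - j * n))`_h =
    if (n %| h)%N then b (m - h %/ n)%N else 0.
  rewrite coef_sum big_mkord; case: ifPn => [/dvdnP[s hs]|ndvd].
    have sm : (s <= m)%N by rewrite hs in h_lt; nia.
    have sm' : (m - s < m.+1)%N by rewrite ltnS leq_subr.
    rewrite (bigD1 (Ordinal sm')) //= big1 ?addr0; last first.
      move=> j /eqP jm; rewrite coefZ coefXn hs -mulnBl eqn_pmul2r //.
      case: eqP => [sE|_]; last by rewrite mulr0.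
      by case: jm; apply/val_inj; rewrite /= sE subKn // -ltnS.
    by rewrite coefZ coefXn hs mulnK // -mulnBl subKn ?eqxx ?mulr1.
  rewrite big1 // => j _; rewrite coefZ coefXn -mulnBl.
  case: eqP => [hE|_]; last exact: mulr0.
  by rewrite hE dvdn_mull in ndvd.
rewrite coefB coefD coefZ coefXnM bE.
have -> : ((- A) ^+ n)`_h = (-1) ^+ n * beta n m alpha h n.
  by rewrite -scaleN1r exprZn coefZ.
rewrite (beta_coef supp) //; case: ifPn => [/dvdnP[s hs]|ndvd].
  have sq : (s <= q.+1)%N by rewrite hs hm in h_lt; nia.
  rewrite hs mulnK // sn_neq_m mulr0 addr0 h1 // signrMK.
  case: ltnP => [|ms]; first by rewrite mulr0 addr0 subrr.
  rewrite low; last by rewrite hs in h_lt; lia.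
  by rewrite subn_eq0 leq_eqVlt ltnNge ms sn_neq_m !mulr0 addr0 subrr.
rewrite add0r subr0; have [->|hm'] := eqVneq h m.
  rewrite ltnn subnn low // eqxx !mulr1 h2.
  rewrite -[- alpha 0%N]mulN1r exprMn -(mulrCA (a n.-1)) -mulrDr.
  have -> : (-1) ^+ n = - (-1) ^+ n.-1 :> C.
    by rewrite -[in LHS](prednK hn) exprS mulN1r.
  by rewrite mulNr addNr mulr0.
rewrite !mulr0 add0r; case: ltnP => [|mh]; first by rewrite mulr0.
rewrite low; last by lia.
by rewrite subn_eq0 leq_eqVlt (negPf hm') ltnNge mh !mulr0.
Qed.

End Support.
End Symbol.

(** * Exponential factors encoded by polynomials *)

Lemma sum_multiples (V : nmodType) (G : nat -> V) e N K : (0 < e)%N ->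
    (forall s, (s * e < N)%N = (s < K)%N) ->
  \sum_(j < N) (if (e %| j)%N then G (j %/ e)%N else 0) = \sum_(s < K) G s.
Proof.
move=> e0 NK; pose D j s := if j == (s * e)%N then G s else 0.
transitivity (\sum_(j < N) \sum_(s < K) D j s).
  apply: eq_bigr => j _; rewrite /D; case: ifPn => [/dvdnP[s js]|ndvd].
    have sK : (s < K)%N by rewrite -NK -js.
    rewrite js mulnK // (bigD1 (Ordinal sK)) //= eqxx big1 ?addr0 // => i.
    by rewrite eqn_pmul2r // -val_eqE eq_sym => /negPf ->.
  by rewrite big1 // => s _; case: eqP ndvd => // ->; rewrite dvdn_mull.
rewrite exchange_big; apply: eq_bigr => s _.
have sN : (s * e < N)%N by rewrite NK.
rewrite (bigD1 (Ordinal sN)) //= /D eqxx big1 ?addr0 // => j.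
by rewrite -val_eqE => /negPf ->.
Qed.

Section Exponential.
Variable C : numClosedFieldType.
Implicit Types (W p : {poly C}) (Q : puiseux C) (M E N e : nat).

(** The Q for which -z^2 Q' = t^-M W(t), where t = z^(1/E): the coefficients of
W are divided by the exponents of x that integration produces. *)
Definition exponential M E W : puiseux C :=
  \sum_(j < M + E)
    << E%:R / (M + E - j)%:R * W`_j *g - ((M + E - j)%:R / E%:R) >>.

Lemma exponential_rev M E W (p : nat -> C) : p 0%N = 0 ->
    (forall j, (0 < j <= M + E)%N -> p j = E%:R / j%:R * W`_(M + E - j)) ->
  exponential M E W = \sum_(j < (M + E).+1) << p j *g - (j%:R / E%:R) >>.
Proof.
move=> p0 pE; rewrite big_ord_recl p0 raddf0 add0r.
rewrite /exponential (reindex_inj rev_ord_inj); apply: eq_bigr => j _ /=.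
have jN := ltn_ord j; rewrite pE /bump /=; last by lia.
by rewrite subKn.
Qed.

Lemma exponential_exp_factor M E W : exp_factor E (exponential M E W).
Proof.
pose p j := if (0 < j)%N then E%:R / j%:R * W`_(M + E - j) else 0.
exists (\poly_(j < (M + E).+1) p j); split; first by rewrite coef_poly.
rewrite (@exponential_rev _ _ _ p) // => [|j /andP[j0 _]]; last by rewrite /p j0.
rewrite (big_ord_widen_cond _ predT
  (fun j => << p j *g - (j%:R / E%:R) >> : puiseux C) (leqnn (M + E).+1)) /=.
have hsz := size_poly (M + E).+1 p.
rewrite [RHS](big_ord_widen_cond _ predT
  (fun j => << (\poly_(j < (M + E).+1) p j)`_j *g - (j%:R / E%:R) >> : puiseux C) hsz) /=.
rewrite [RHS]big_mkcond [LHS]big_mkcond /=.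
apply: eq_bigr => j _; rewrite ltn_ord coef_poly ltn_ord.
case: ltnP => // /leq_sizeP/(_ _ (leqnn _)); rewrite coef_poly ltn_ord => ->.
exact: raddf0.
Qed.

(** The lower bound M0 on M lets all the cases where z^2 Q' has a small pole in t
be treated together; when M exceeds M0, it is the exact order of this pole. *)
Lemma exp_factor_exponential E Q M0 : (0 < E)%N -> exp_factor E Q ->
  exists M W, [/\ (M0 <= M)%N, (size W <= M + E)%N, Q = exponential M E W
                & M = M0 \/ W`_0 != 0].
Proof.
move=> E0 [p [p0 ->]].
(* z^2 Q' has order E - (size p - 1) in t. *)
pose M := maxn M0 ((size p).-1 - E).
pose W := \poly_(i < M + E) ((M + E - i)%:R / E%:R * p`_(M + E - i)).
have En0 : E%:R != 0 :> C by rewrite pnatr_eq0 -lt0n.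
exists M, W; split; [exact: leq_maxl|exact: size_poly| |].
  rewrite (@exponential_rev _ _ _ (fun j => p`_j)) //; last first.
    move=> j /andP[j0 jN]; rewrite coef_poly subKn // (_ : _ < _)%N; last by lia.
    by field; rewrite En0 pnatr_eq0 -lt0n.
  have hsz : (size p <= (M + E).+1)%N by rewrite /M; lia.
  rewrite (big_ord_widen_cond _ predT
    (fun j => << p`_j *g - (j%:R / E%:R) >> : puiseux C) hsz) big_mkcond /=.
  apply: eq_bigr => j _; case: ltnP => // szj.
  by rewrite nth_default // raddf0.
have [|lt] := leqP ((size p).-1 - E) M0; first by move=> le; left; apply/maxn_idPl.
right; rewrite coef_poly subn0 addn_gt0 E0 orbT mulf_neq0 //.
  by rewrite mulf_neq0 ?invr_eq0 // pnatr_eq0; lia.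
have -> : (M + E = (size p).-1)%N by rewrite /M; lia.
by rewrite -lead_coefE lead_coef_eq0; apply: contraTneq lt => ->; rewrite size_poly0.
Qed.

Lemma exponential_comp_Xn M E e W : (0 < e)%N -> (0 < E)%N ->
  exponential (M * e) (E * e) (W \Po 'X^e) = exponential M E W.
Proof.
move=> e0 E0.
rewrite -[RHS](@sum_multiples _ (fun j => << E%:R / (M + E - j)%:R * W`_j
    *g - ((M + E - j)%:R / E%:R) >> : puiseux C) e ((M + E) * e)) //; last first.
  by move=> s; rewrite ltn_pmul2r.
rewrite /exponential -mulnDl; apply: eq_bigr => j _.
rewrite coef_comp_poly_Xn //; case: ifPn => [/dvdnP[s ->]|_]; last first.
  by rewrite mulr0 raddf0.
rewrite mulnK // -mulnBl !natrM.
by rewrite -!mulf_div !divff ?mulr1 // pnatr_eq0 -lt0n.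
Qed.

Lemma exponentialD M E W1 W2 :
  exponential M E (W1 + W2) = exponential M E W1 + exponential M E W2.
Proof.
by rewrite -big_split; apply: eq_bigr => j _; rewrite coefD mulrDr monalgUD.
Qed.

Lemma exponentialN M E W : exponential M E (- W) = - exponential M E W.
Proof. by rewrite -sumrN; apply: eq_bigr => j _; rewrite coefN mulrN monalgUN. Qed.

Lemma mcoeff_exponential M E W : (0 < E)%N ->
  (exponential M E W)@_(- ((M + E)%:R / E%:R)) = E%:R / (M + E)%:R * W`_0.
Proof.
move=> E0; have ME : (0 < M + E)%N by rewrite addn_gt0 E0 orbT.
rewrite raddf_sum (bigD1 (Ordinal ME)) //= subn0 mcoeffUU big1 ?addr0 // => j.
rewrite -val_eqE /= => j0; rewrite mcoeffU eqr_opp.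
rewrite (inj_eq (mulIf _)) ?invr_eq0 ?pnatr_eq0 -?lt0n // eqr_nat.
by rewrite (_ : _ == _ = false) //; have := ltn_ord j; lia.
Qed.

Lemma airy_Q_exponential n q r m alpha :
    (1 <= n)%N -> (1 <= q)%N -> (0 < r < n)%N -> m = (q * n + r)%N ->
    alpha_support n q m alpha ->
  airy_Q n q m alpha = exponential m n (- \poly_(i < m + n) alpha i).
Proof.
move=> hn hq hr hm supp; have n0 (K : numFieldType) : n%:R != 0 :> K.
  by rewrite pnatr_eq0 -lt0n.
rewrite exponentialN (support_decomposition hn hq hr hm supp).
rewrite exponentialD /airy_Q; congr (- (_ + _)).
  pose G s : puiseux C := << n%:R / (m + n - s * n)%:R * alpha (s * n)%N
           *g - ((m + n - s * n)%:R / n%:R) >>.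
  have le s : (s < q.+2)%N -> (s * n <= m + n)%N by rewrite hm; nia.
  transitivity (\sum_(s < q.+2) G s).
    apply: eq_bigr => s _; congr (mkmalgU _ _); rewrite natrB ?le // natrD.
      by rewrite natrM; field; exact: n0.
    by rewrite [m%:R + _]addrC.
  rewrite -(@sum_multiples _ _ n (m + n)) //; last by move=> s; rewrite hm; nia.
  rewrite /exponential; apply: eq_bigr => j _.
  rewrite coef_comp_poly_Xn //; case: ifPn => [/dvdnP[s js]|_]; last first.
    by rewrite mulr0 raddf0.
  rewrite js mulnK // coef_poly (_ : (s < q.+2)%N) //.
  by have := ltn_ord j; rewrite js hm; nia.
have mN : (m < m + n)%N by lia.
rewrite /exponential (bigD1 (Ordinal mN)) //= big1 ?addr0; last first.
  by move=> j; rewrite -val_eqE coefZ coefXn => /negPf ->; rewrite !mulr0 raddf0.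
rewrite coefZ coefXn eqxx addKn mulr1 !divff ?n0 // ?mul1r; congr (mkmalgU _ _).
by rewrite opprD -addrA addNr addr0.
Qed.

End Exponential.

(** * Action of the operator on the e^Q-component *)

Section Components.
Variable C : numClosedFieldType.
Implicit Types (g : C -> nat -> C) (P W : {poly C}) (Q : puiseux C).
Implicit Types (mu nu c : C) (M E N i j k d n m : nat) (a b : nat -> C).

(** The action of d/dx on the coefficient of e^Q.  No two exponential factors
interact, so every question reduces to this operator for a fixed Q. *)
Definition dxQ Q g mu k : C :=
  - (\sum_(rho <- msupp Q) ratr rho * Q@_rho * g (mu - 2 - (ratr rho - 1)) k
     + (mu - 2 + 1) * g (mu - 2 + 1) k + k.+1%:R * g (mu - 2 + 1) k.+1).

Definition airyQ n m a b Q g mu k : C :=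
  \sum_(1 <= i < n.+1) a i * iter i (dxQ Q) g mu k
  - \sum_(0 <= j < m.+1) b j * g (mu + j%:R) k.

Lemma airy_op_component n m a b (F : formal C) Q mu k :
  airy_op n m a b F Q mu k = airyQ n m a b Q (F Q) mu k.
Proof.
rewrite /airy_op /airyQ; congr (_ - _); apply: eq_bigr => i _; congr (_ * _).
  suff -> : iter i (@ddx C) F Q = iter i (dxQ Q) (F Q) by [].
  by elim: i => //= i <-.
elim: i mu => [|i IHi] mu /=; first by rewrite addr0.
by rewrite /mulx IHi; congr (F Q _ k); rewrite -natr1; ring.
Qed.

Section Action.
Variable h : C.

(** Multiplication by P(t) with t = z^h. *)
Definition act P g : C -> nat -> C :=
  fun mu k => \sum_(i < size P) P`_i * g (mu - i%:R * h) k.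

(** Only the class of nu modulo h Z is constrained: all operators below shift
exponents by multiples of h, so they preserve this condition up to a shift. *)
Definition ord_ge nu g := forall j k, (0 < j)%N -> g (nu - j%:R * h) k = 0.

Lemma act_widen N P g mu k : (size P <= N)%N ->
  act P g mu k = \sum_(i < N) P`_i * g (mu - i%:R * h) k.
Proof.
move=> PN; rewrite /act (big_ord_widen _ (fun i => P`_i * g (mu - i%:R * h) k) PN).
rewrite big_mkcond /=; apply: eq_bigr => i _; case: ltnP => // Pi.
by rewrite nth_default ?mul0r.
Qed.

Lemma actD P1 P2 g mu k : act (P1 + P2) g mu k = act P1 g mu k + act P2 g mu k.
Proof.
pose N := maxn (size P1) (size P2).
rewrite !(@act_widen N) ?leq_maxl ?leq_maxr ?size_polyD // -big_split.
by apply: eq_bigr => i _; rewrite coefD mulrDl.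
Qed.

Lemma actZ c P g mu k : act (c *: P) g mu k = c * act P g mu k.
Proof.
rewrite (act_widen _ _ _ (size_scale_leq c P)) mulr_sumr.
by apply: eq_bigr => i _; rewrite coefZ mulrA.
Qed.

Lemma act0 g mu k : act 0 g mu k = 0.
Proof. by rewrite /act size_poly0 big_ord0. Qed.

Lemma actN P g mu k : act (- P) g mu k = - act P g mu k.
Proof. by rewrite -scaleN1r actZ mulN1r. Qed.

Lemma act_sum I (r : seq I) (p : I -> {poly C}) g mu k :
  act (\sum_(i <- r) p i) g mu k = \sum_(i <- r) act (p i) g mu k.
Proof.
elim/big_rec2: _ => [|i x P _ <-]; first exact: act0.
exact: actD.
Qed.

Lemma act1 g mu k : act 1 g mu k = g mu k.
Proof. by rewrite /act size_poly1 big_ord1 coefC mul1r mul0r subr0. Qed.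

Lemma actXM P g mu k : act ('X * P) g mu k = act P g (mu - h) k.
Proof.
rewrite (@act_widen (size P).+1); last first.
  by rewrite mulrC (leq_trans (size_polyMleq _ _)) // size_polyX addn2.
rewrite big_ord_recl coefXM mul0r add0r; apply: eq_bigr => i _.
by rewrite coefXM /=; congr (_ * g _ k); rewrite /bump /= natrD; ring.
Qed.

Lemma actXnM d P g mu k : act ('X^d * P) g mu k = act P g (mu - d%:R * h) k.
Proof.
elim: d mu => [|d IHd] mu; first by rewrite expr0 mul1r mul0r subr0.
by rewrite exprS -mulrA actXM IHd; congr (act P g _ k); rewrite -natr1; ring.
Qed.

Lemma actM P1 P2 g mu k : act (P1 * P2) g mu k = act P1 (act P2 g) mu k.
Proof.
rewrite -{1}[P1]coefK poly_def mulr_suml act_sum; apply: eq_bigr => i _.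
by rewrite -scalerAl actZ actXnM.
Qed.

Lemma act_ord_lead P g nu d k : ord_ge nu g -> (forall i, (i < d)%N -> P`_i = 0) ->
  act P g (nu + d%:R * h) k = P`_d * g nu k.
Proof.
move=> g0 P0; have dN : (d < maxn (size P) d.+1)%N by rewrite leq_max leqnn orbT.
rewrite (@act_widen (maxn (size P) d.+1)) ?leq_maxl //.
rewrite (bigD1 (Ordinal dN)) //= addrK big1 ?addr0 // => i.
rewrite -val_eqE /= neq_ltn => /orP[id|di]; first by rewrite P0 ?mul0r.
rewrite (_ : _ - _ = nu - (i - d)%:R * h) ?g0 ?subn_gt0 ?mulr0 //.
by rewrite natrB 1?ltnW //; ring.
Qed.

Lemma act_ord P g nu k : ord_ge nu g -> act P g nu k = P`_0 * g nu k.
Proof. by move=> g0; rewrite -(@act_ord_lead P g nu 0) // mul0r addr0. Qed.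

Lemma ord_ge_sub nu g i : ord_ge nu g -> ord_ge (nu - i%:R * h) g.
Proof.
move=> g0 j k j0; rewrite (_ : _ - _ = nu - (i + j)%:R * h) ?g0 ?ltn_addl //.
by rewrite natrD; ring.
Qed.

Lemma ord_ge_act P g nu : ord_ge nu g -> ord_ge nu (act P g).
Proof. by move=> g0 j k j0; rewrite act_ord ?g0 ?mulr0 //; apply: ord_ge_sub. Qed.

End Action.

Lemma dxQ_exponential M E W g mu k : (0 < E)%N -> (size W <= M + E)%N ->
  let h := E%:R^-1 in
  dxQ (exponential M E W) g mu k = act h W g (mu + M%:R * h) k
    - ((mu - E%:R * h) * g (mu - E%:R * h) k
       + k.+1%:R * g (mu - E%:R * h) k.+1).
Proof.
move=> E0 sW h; have En0 : E%:R != 0 :> C by rewrite pnatr_eq0 -lt0n.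
have Eh : E%:R * h = 1 by rewrite divff.
rewrite /dxQ Eh (_ : mu - 2 + 1 = mu - 1); last by ring.
rewrite -addrA opprD; congr (_ - _).
pose w rho := ratr rho * g (mu - 2 - (ratr rho - 1)) k.
transitivity (- mmap idfun w (exponential M E W)).
  by congr (- _); rewrite mmapE; apply: eq_bigr => rho _; rewrite /w /=; ring.
have mU (c : C) rho : mmap idfun w << c *g rho >> = c * w rho.
  exact: (@mmapU _ _ _ idfun w).
rewrite (raddf_sum (mmap idfun w)) -sumrN (act_widen _ _ _ _ sW); apply: eq_bigr => j _.
transitivity (- (E%:R / (M + E - j)%:R * W`_j * w (- ((M + E - j)%:R / E%:R)))).
  by congr (- _); exact: mU.
rewrite /w; set d := (M + E - j)%N.
have d0 : (0 < d)%N by have := ltn_ord j; rewrite /d; lia.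
have ratrE : ratr (- (d%:R / E%:R)) = - (d%:R * h) :> C.
  by rewrite rmorphN fmorph_div !rmorph_nat.
have dn0 : d%:R != 0 :> C by rewrite pnatr_eq0 -lt0n.
rewrite ratrE mulrA -mulNr; congr (_ * g _ k).
  by rewrite /h; field; rewrite En0 dn0.
have -> : j%:R = M%:R + E%:R - d%:R :> C.
  by rewrite -natrD -natrB ?leq_subr // subKn // ltnW.
by rewrite !mulrBl mulrDl Eh; ring.
Qed.

Section Expansion.
Variables (n m e M : nat) (a b : nat -> C) (W : {poly C}) (g : C -> nat -> C) (nu : C).
Hypotheses (n0 : (0 < n)%N) (e0 : (0 < e)%N) (sW : (size W <= M + n * e)%N)
  (mM : (m * e <= M)%N) (an : a n = 1).
Let E := (n * e)%N.
Let h : C := E%:R^-1.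
Let Q := exponential M E W.
Let E0 : (0 < E)%N. Proof. by rewrite muln_gt0 n0. Qed.

(** The difference between (t^-M W + D)^i and t^-(Mi) W^i, which measures the failure
of D to commute with W. *)
Definition remainder i mu k :=
  iter i (dxQ Q) g mu k - act h (W ^+ i) g (mu + (i * M)%:R * h) k.

Lemma iter_dxQ i mu k : iter i (dxQ Q) g mu k =
  act h (W ^+ i) g (mu + (i * M)%:R * h) k + remainder i mu k.
Proof. by rewrite addrC subrK. Qed.

Lemma act_shift P f c mu k :
  act h P (fun mu k => f (mu + c) k) mu k = act h P f (mu + c) k.
Proof. by apply: eq_bigr => i _; rewrite addrAC. Qed.

Lemma remainderS i mu k : remainder i.+1 mu k =
  act h W (remainder i) (mu + M%:R * h) k
  - ((mu - E%:R * h) * iter i (dxQ Q) g (mu - E%:R * h) k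
     + k.+1%:R * iter i (dxQ Q) g (mu - E%:R * h) k.+1).
Proof.
rewrite /remainder iterS dxQ_exponential // -/h addrAC; congr (_ - _).
rewrite exprS actM (_ : mu + (i.+1 * M)%:R * h = mu + M%:R * h + (i * M)%:R * h).
  rewrite -(act_shift _ _ ((i * M)%:R * h)) /act -sumrB.
  by apply: eq_bigr => j _; rewrite -mulrBr.
by rewrite mulSn natrD; ring.
Qed.

Hypothesis gnu : ord_ge h nu g.
Let pole i := nu + (M + E)%:R * h - (i * M)%:R * h.

(** Every term of the remainder contains a factor D, which raises exponents by 1
instead of lowering them by M h, whence the bound pole i.  A term with exactly
one D contributes at that order: there W may be replaced by W(0), and D acts
on z^(nu - j M h), j < i, which produces the binomial coefficient. *)
Lemma remainder_lead i :
  ord_ge h (pole i) (remainder i) /\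
  forall k, remainder i (pole i) k =
    - (W`_0 ^+ i.-1 * ((i%:R * nu - ('C(i, 2) * M)%:R * h) * g nu k
                       + i%:R * k.+1%:R * g nu k.+1)).
Proof.
elim: i => [|i [IH0 IH1]].
  have R0 mu k : remainder 0 mu k = 0.
    by rewrite /remainder expr0 act1 mul0n mul0r addr0 subrr.
  by split=> [j k _|k]; rewrite R0 // bin0n mul0n !mul0r subrr !mul0r addr0 mulr0 oppr0.
have itE j k : iter i (dxQ Q) g (pole i.+1 - j%:R * h - E%:R * h) k
   = if (j == 0)%N then W`_0 ^+ i * g nu k else 0.
  rewrite iter_dxQ (_ : _ + (i * M)%:R * h = nu - j%:R * h); last first.
    by rewrite /pole mulSn !natrD; ring.
  rewrite (_ : _ - E%:R * h = pole i - (M + E + j)%:R * h); last first.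
    by rewrite /pole mulSn !natrD; ring.
  rewrite IH0 ?addr0; last by lia.
  case: j => [|j]; last exact: ord_ge_act.
  by rewrite mul0r subr0 act_ord // coef0_exp.
have pS j : pole i.+1 - j%:R * h + M%:R * h = pole i - j%:R * h.
  by rewrite /pole mulSn !natrD; ring.
split=> [j k j0|k].
  rewrite remainderS pS !itE gtn_eqF // !mulr0 addr0 subr0.
  exact: ord_ge_act.
have p0 : pole i.+1 = pole i.+1 - 0%:R * h by rewrite mul0r subr0.
rewrite p0 remainderS pS !itE eqxx mul0r !subr0 act_ord // IH1 /=.
have -> : pole i.+1 - E%:R * h = nu - (i * M)%:R * h.
  by rewrite /pole mulSn !natrD; ring.
rewrite binS bin1 !(natrD, natrM) -natr1.
by case: (i) => [|l]; rewrite /= ?exprS ?expr0 ?(bin_small (ltn0Sn 1)); ring.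
Qed.

Lemma airyQ_expand mu k : airyQ n m a b Q g mu k =
  act h (symbol n m a b e M W) g (mu + (n * M)%:R * h) k
  + \sum_(1 <= i < n.+1) a i * remainder i mu k.
Proof.
have Eh : E%:R * h = 1 by rewrite divff // pnatr_eq0 -lt0n.
rewrite /symbol actD actN !act_sum addrAC; congr (_ - _).
  rewrite -big_split /= !big_nat; apply: eq_bigr => i /andP[_ i_le].
  rewrite actZ actXnM iter_dxQ mulrDr; congr (_ * act h _ g _ k + _).
  rewrite (_ : (n * M = i * M + M * (n - i))%N); last by nia.
  by rewrite natrD; ring.
rewrite !big_nat; apply: eq_bigr => j /andP[_ j_le].
rewrite actZ -[X in act h X]mulr1 actXnM act1; congr (_ * g _ k).
rewrite (_ : (n * M = M * n - j * (n * e) + j * E)%N); last by rewrite /E; nia.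
by rewrite natrD mulrDl [in X in _ + (_ + X) - _]natrM -mulrA Eh; ring.
Qed.

(** Below order M + E the operator acts on leading terms through the symbol
alone. *)
Lemma airyQ_lead d k : (d < M + E)%N ->
    (forall i, (i < d)%N -> (symbol n m a b e M W)`_i = 0) ->
  airyQ n m a b Q g (nu + d%:R * h - (n * M)%:R * h) k
  = (symbol n m a b e M W)`_d * g nu k.
Proof.
move=> d_lt S0; rewrite airyQ_expand subrK act_ord_lead //.
rewrite big_nat big1 ?addr0 // => i /andP[_ i_le].
have [R0 _] := remainder_lead i.
rewrite (_ : _ - _ = pole i - (M * (n - i) + (M + E - d))%:R * h); last first.
  rewrite /pole (_ : (n * M = i * M + M * (n - i))%N); last by nia.
  by rewrite !natrD natrB 1?ltnW // natrD; ring.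
by rewrite R0 ?mulr0 // addn_gt0 subn_gt0 d_lt orbT.
Qed.

(** The first order at which the derivation is felt: only the remainder of index n
contributes, which makes the equation linear in nu. *)
Lemma airyQ_indicial k : (0 < M)%N ->
    (forall i, (i < M + E)%N -> (symbol n m a b e M W)`_i = 0) ->
  airyQ n m a b Q g (nu + (M + E)%:R * h - (n * M)%:R * h) k
  = (symbol n m a b e M W)`_(M + E) * g nu k
    - W`_0 ^+ n.-1 * ((n%:R * nu - ('C(n, 2) * M)%:R * h) * g nu k
                       + n%:R * k.+1%:R * g nu k.+1).
Proof.
move=> M0 S0; rewrite airyQ_expand subrK act_ord_lead //; congr (_ + _).
rewrite big_nat_recr //= an mul1r big_nat big1 ?add0r => [|i /andP[_ i_lt]].
  exact: (remainder_lead n).2.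
have [R0 _] := remainder_lead i.
rewrite (_ : _ - _ = pole i - (M * (n - i))%:R * h); last first.
  rewrite /pole (_ : (n * M = i * M + M * (n - i))%N); last by nia.
  by rewrite !natrD; ring.
by rewrite R0 ?mulr0 // muln_gt0 M0 subn_gt0.
Qed.

End Expansion.
End Components.

(** * Solutions with a given exponential factor *)

Section LocalSolutions.
Variable C : numClosedFieldType.
Implicit Types (g : C -> nat -> C) (P W : {poly C}) (Q : puiseux C).
Implicit Types (mu nu c h : C) (M E N i j k d n m : nat) (a b : nat -> C).

(** On each class of exponents modulo h Z the support is bounded below, with no
uniformity over classes.  Unlike having all exponents in lambda + h N, this
condition is stable under sums. *)
Definition bounded_below h g :=
  forall mu, exists N, forall j k, (N <= j)%N -> g (mu - j%:R * h) k = 0.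

Definition log_finite g := exists K, forall mu k, (K <= k)%N -> g mu k = 0.

Definition comb c g1 g2 : C -> nat -> C := fun mu k => g1 mu k + c * g2 mu k.

Definition airyQ_sol n m a b Q g := forall mu k, airyQ n m a b Q g mu k = 0.

(** A nonzero function with this property has a leading term in some class. *)
Lemma bounded_below_eq0 h g : bounded_below h g ->
  (forall nu, ord_ge h nu g -> forall k, g nu k = 0) -> forall mu k, g mu k = 0.
Proof.
move=> bb lead0 mu k; have [N gN] := bb mu.
suff H i j l : (N <= j + i)%N -> g (mu - j%:R * h) l = 0.
  by have := H N 0%N k (leqnn _); rewrite mul0r subr0.
elim: i j l => [|i IHi] j l; first by rewrite addn0; apply: gN.
move=> Nj; apply: lead0 => d l' d0.
by rewrite -addrA -opprD -mulrDl -natrD IHi //; lia.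
Qed.

Lemma bounded_below_comb h c g1 g2 :
  bounded_below h g1 -> bounded_below h g2 -> bounded_below h (comb c g1 g2).
Proof.
move=> b1 b2 mu; have [N1 h1] := b1 mu; have [N2 h2] := b2 mu.
exists (maxn N1 N2) => j k; rewrite geq_max /comb.
by move=> /andP[/h1-> /h2->]; rewrite mulr0 addr0.
Qed.

Lemma log_finite_comb c g1 g2 :
  log_finite g1 -> log_finite g2 -> log_finite (comb c g1 g2).
Proof.
move=> [K1 h1] [K2 h2].
exists (maxn K1 K2) => mu k; rewrite geq_max /comb.
by move=> /andP[/h1-> /h2->]; rewrite mulr0 addr0.
Qed.

Lemma dxQ_comb Q c g1 g2 : dxQ Q (comb c g1 g2) = comb c (dxQ Q g1) (dxQ Q g2).
Proof.
apply/funext => mu; apply/funext => k; rewrite /dxQ /comb.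
under eq_bigr do rewrite mulrDr mulrCA.
by rewrite big_split /= -mulr_sumr; ring.
Qed.

Lemma airyQ_comb n m a b Q c g1 g2 mu k :
  airyQ n m a b Q (comb c g1 g2) mu k =
  airyQ n m a b Q g1 mu k + c * airyQ n m a b Q g2 mu k.
Proof.
have iterE i :
    iter i (dxQ Q) (comb c g1 g2) = comb c (iter i (dxQ Q) g1) (iter i (dxQ Q) g2).
  by elim: i => //= i ->; rewrite dxQ_comb.
rewrite /airyQ mulrBr !mulr_sumr addrACA -big_split -opprD -big_split /=.
congr (_ - _); apply: eq_bigr => i _; first by rewrite iterE /comb mulrDr mulrCA.
by rewrite /comb mulrDr mulrCA.
Qed.

Lemma airyQ_log_free n m a b Q g : (forall mu k, (0 < k)%N -> g mu k = 0) ->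
  forall mu k, (0 < k)%N -> airyQ n m a b Q g mu k = 0.
Proof.
move=> g0 mu k k0; rewrite /airyQ !big1 ?subrr // => i _; first by rewrite g0 ?mulr0.
suff -> : iter i (dxQ Q) g mu k = 0 by rewrite mulr0.
elim: i mu k k0 => [|i IHi] mu k k0; first exact: g0.
by rewrite /= /dxQ !IHi // !mulr0 !addr0 big1 ?oppr0 // => rho _; rewrite IHi ?mulr0.
Qed.

Section NonAiry.
Variables (n m e M : nat) (a b : nat -> C) (W : {poly C}).
Hypotheses (n0 : (0 < n)%N) (e0 : (0 < e)%N) (sW : (size W <= M + n * e)%N)
  (mM : (m * e <= M)%N).
Let E := (n * e)%N.
Let h : C := E%:R^-1.
Let Q := exponential M E W.
Let S := symbol n m a b e M W.

(** The lowest nonzero coefficient of the symbol multiplies the leading term of a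
solution, which must then vanish. *)
Lemma symbol_obstruction g : airyQ_sol n m a b Q g -> bounded_below h g ->
  (exists2 d, (d < M + E)%N & S`_d != 0) -> forall mu k, g mu k = 0.
Proof.
move=> sol bb [d d_lt Sd]; apply: (bounded_below_eq0 bb) => nu gnu k.
have exS : exists d, S`_d != 0 by exists d.
have Smin := ex_minnP exS; case: Smin => d' Sd' mind.
have d'_lt : (d' < M + E)%N by apply: leq_ltn_trans d_lt; apply: mind.
have S0 i : (i < d')%N -> S`_i = 0.
  by move=> id'; apply: contraTeq id' => /mind; rewrite leqNgt.
have := airyQ_lead n0 e0 sW mM gnu k d'_lt S0; rewrite sol.
by move/esym/eqP; rewrite mulf_eq0 (negPf Sd') => /eqP.
Qed.

Hypotheses (an : a n = 1) (M0 : (0 < M)%N) (W0 : W`_0 != 0)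
  (S0 : forall i, (i < M + E)%N -> S`_i = 0).

Definition indicial_root : C :=
  (S`_(M + E) / W`_0 ^+ n.-1 + ('C(n, 2) * M)%:R * h) / n%:R.

Let nn0 : n%:R != 0 :> C. Proof. by rewrite pnatr_eq0 -lt0n. Qed.

Lemma airyQ_indicial_root g nu k : ord_ge h nu g ->
  airyQ n m a b Q g (nu + (M + E)%:R * h - (n * M)%:R * h) k =
  - (n%:R * W`_0 ^+ n.-1)
    * ((nu - indicial_root) * g nu k + k.+1%:R * g nu k.+1).
Proof.
move=> gnu; rewrite (airyQ_indicial n0 e0 sW mM an gnu k M0 S0).
rewrite /indicial_root -/S -/E -/h; have Wn : W`_0 ^+ n.-1 != 0 by rewrite expf_neq0.
move: (h) (W`_0 ^+ n.-1) Wn => h' w wn0.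
by field; rewrite nn0 wn0.
Qed.

(** At a leading exponent nu the equation is (nu - rho) p + p' = 0, where rho is the
indicial root and p a polynomial in log z.  If nu is not rho then p = 0;
otherwise p is constant, and this constant is zero by assumption. *)
Lemma indicial_root_uniq g : airyQ_sol n m a b Q g -> bounded_below h g ->
  log_finite g -> g indicial_root 0%N = 0 -> forall mu k, g mu k = 0.
Proof.
move=> sol bb [K gK] g0; apply: (bounded_below_eq0 bb) => nu gnu.
have eqn k : (nu - indicial_root) * g nu k + k.+1%:R * g nu k.+1 = 0.
  have /eqP := airyQ_indicial_root k gnu; rewrite sol eq_sym mulf_eq0 oppr_eq0.
  by rewrite mulf_eq0 (negPf nn0) expf_eq0 (negPf W0) andbF => /eqP.
have [nuE|nu_neq] := eqVneq nu indicial_root.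
  case=> [|k]; first by rewrite nuE.
  by have /eqP := eqn k; rewrite nuE subrr mul0r add0r mulf_eq0 pnatr_eq0 => /eqP.
suff H i k : (K <= k + i)%N -> g nu k = 0 by move=> k; apply: (H K); rewrite leq_addl.
elim: i k => [|i IHi] k; first by rewrite addn0; apply: gK.
move=> Kk; have := eqn k; rewrite (IHi k.+1) ?mulr0 ?addr0; last by lia.
by move/eqP; rewrite mulf_eq0 subr_eq0 (negPf nu_neq) => /eqP.
Qed.

(** A nonzero solution has a nonzero coefficient at the indicial root, so a
combination of two solutions can be made to vanish there. *)
Lemma solutions_proportional g1 g2 :
    airyQ_sol n m a b Q g1 -> bounded_below h g1 -> log_finite g1 ->
    airyQ_sol n m a b Q g2 -> bounded_below h g2 -> log_finite g2 ->
    (exists mu k, g2 mu k != 0) ->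
  exists c, forall mu k, g1 mu k = c * g2 mu k.
Proof.
move=> s1 b1 l1 s2 b2 l2 [mu [k g2n0]].
have g20 : g2 indicial_root 0%N != 0.
  by apply: contra_neq g2n0 => g20; apply: indicial_root_uniq.
pose c := g1 indicial_root 0%N / g2 indicial_root 0%N.
exists c => nu l; apply/eqP; rewrite -subr_eq0 -mulNr; apply/eqP.
apply: (@indicial_root_uniq (comb (- c) g1 g2)).
- by move=> mu' k'; rewrite airyQ_comb s1 s2 mulr0 addr0.
- exact: bounded_below_comb.
- exact: log_finite_comb.
- by rewrite /comb /c mulNr mulfVK // subrr.
Qed.

Definition series_at nu (s : nat -> C) : C -> nat -> C := fun mu k =>
  if k is 0 then
    match pselect (exists j, mu = nu + j%:R * h) with
    | left ex => s (projT1 (cid ex))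
    | right _ => 0
    end
  else 0.

Let h0 : h != 0. Proof. by rewrite invr_eq0 pnatr_eq0 -lt0n muln_gt0 n0. Qed.

Lemma series_atE nu s j k :
  series_at nu s (nu + j%:R * h) k = if k == 0%N then s j else 0.
Proof.
case: k => //=; case: pselect => [ex|nex]; last by case: nex; exists j.
case: (cid ex) => i /= iE; suff -> : j = i by [].
by move/addrI: iE => /(mulIf h0)/eqP; rewrite eqr_nat => /eqP.
Qed.

Lemma series_at_out nu s mu k :
  (forall j, mu <> nu + j%:R * h) -> series_at nu s mu k = 0.
Proof. by case: k => //= out; case: pselect => // ex; have [j /out] := ex. Qed.

(** The operator is causal: it never moves a term to a relative order below
M + E. *)
Lemma airyQ_local g1 g2 nu k :
    (forall j l, g1 (nu - j%:R * h) l = g2 (nu - j%:R * h) l) ->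
  airyQ n m a b Q g1 (nu + (M + E)%:R * h - (n * M)%:R * h) k =
  airyQ n m a b Q g2 (nu + (M + E)%:R * h - (n * M)%:R * h) k.
Proof.
move=> g12; pose g := comb (-1) g1 g2.
have gz j l : g (nu - j%:R * h) l = 0 by rewrite /g /comb g12 mulN1r subrr.
have gnu : ord_ge h nu g by move=> j l _; apply: gz.
have := airyQ_indicial_root k gnu; rewrite airyQ_comb.
have gnu0 l : g nu l = 0 by have := gz 0%N l; rewrite mul0r subr0.
by rewrite !gnu0 !mulr0 addr0 mulr0 mulN1r => /eqP; rewrite subr_eq0 => /eqP.
Qed.

Let rho0 := indicial_root.
Let T g nu := airyQ n m a b Q g (nu + (M + E)%:R * h - (n * M)%:R * h) 0%N.

Let kappa j : C := - (n%:R * W`_0 ^+ n.-1) * (j%:R * h).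

(** Successive approximations of the solution: step N corrects the coefficient of
exponent rho0 + N h so that the equation holds one order further, which is
possible since kappa N is nonzero for N > 0. *)
Fixpoint partial_series (N : nat) : nat -> C :=
  if N is N'.+1 then fun j =>
    if j == N then - T (series_at rho0 (partial_series N')) (rho0 + N%:R * h) / kappa N
    else partial_series N' j
  else fun j => (j == 0%N)%:R.

Definition series_coef j := partial_series j j.

Lemma partial_series_gt N j : (N < j)%N -> partial_series N j = 0.
Proof.
elim: N => [|N IHN] /= Nj; first by rewrite gtn_eqF.
by rewrite gtn_eqF // IHN // ltnW.
Qed.

Lemma partial_series_le N j : (j <= N)%N -> partial_series N j = series_coef j.
Proof.
elim: N => [|N IHN]; first by rewrite leqn0 => /eqP ->.
rewrite leq_eqVlt => /orP[/eqP -> //|jN]; rewrite -IHN //=.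
by rewrite ltn_eqF.
Qed.

Lemma series_at_sol : airyQ_sol n m a b Q (series_at rho0 series_coef).
Proof.
have lf s mu k : (0 < k)%N -> airyQ n m a b Q (series_at rho0 s) mu k = 0.
  by apply: airyQ_log_free => {}mu [].
move=> mu [|k]; last exact: lf.
pose nu := mu - (M + E)%:R * h + (n * M)%:R * h.
have -> : mu = nu + (M + E)%:R * h - (n * M)%:R * h by rewrite /nu; ring.
have step j i l s : series_at rho0 s (rho0 + j%:R * h - i%:R * h) l =
    if (l == 0%N) && (i <= j)%N then s (j - i)%N else 0.
  case: leqP => [ij|ji]; rewrite ?andbT ?andbF.
    by rewrite -addrA -mulrBl -natrB // series_atE.
  apply: series_at_out => d /eqP; rewrite -subr_eq0 => /eqP dE.
  have : (j + 0)%:R * h = (i + d)%:R * h.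
    by apply/eqP; rewrite -subr_eq0 -dE !natrD; apply/eqP; ring.
  by move/(mulIf h0)/eqP; rewrite eqr_nat; lia.
(* Away from rho0 + h N the operator reads only zero coefficients. *)
have [[j nuE]|out] := pselect (exists j, nu = rho0 + j%:R * h); last first.
  rewrite (@airyQ_local _ (fun _ _ => 0)).
    by rewrite airyQ_indicial_root ?mulr0 ?addr0 ?mulr0 // => i l _.
  move=> i l; apply: series_at_out => d dE; apply: out; exists (d + i)%N.
  by rewrite natrD mulrDl addrA -dE subrK.
(* At rho0 + j h it reads only the coefficients of index at most j. *)
rewrite nuE (@airyQ_local _ (series_at rho0 (partial_series j))); last first.
  move=> i l; rewrite !step; case: ifP => // /andP[_ ij].
  by rewrite partial_series_le // leq_subr.
case: j nuE => [|j] nuE.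
  rewrite airyQ_indicial_root; last first.
    by move=> i l i0; rewrite step leqNgt i0 andbF.
  by rewrite mul0r addr0 subrr mul0r add0r /= !mulr0.
(* The term of index j + 1 was chosen to cancel the value left by the previous
   approximation. *)
pose d1 := series_at rho0 (fun i => (i == j.+1)%:R).
pose t := - T (series_at rho0 (partial_series j)) (rho0 + j.+1%:R * h) / kappa j.+1.
rewrite (@airyQ_local _ (comb t (series_at rho0 (partial_series j)) d1)); last first.
  move=> i l; rewrite /comb /d1 !step; case: ifP => _; last by rewrite mulr0 addr0.
  rewrite /=; case: eqP => [->|_]; last by rewrite mulr0 addr0.
  by rewrite partial_series_gt // add0r mulr1.
have ord1 : ord_ge h (rho0 + j.+1%:R * h) d1.
  move=> i l i0; rewrite /d1 step; case: ifP => // /andP[_ ij].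
  by rewrite (_ : _ == _ = false) //; lia.
rewrite airyQ_comb (airyQ_indicial_root 0 ord1) /d1 series_atE !eqxx.
rewrite [series_at _ _ _ 1%N]/= mulr0 addr0 mulr1 [_ + _ - rho0]addrAC subrr add0r.
rewrite -[- _ * _]/(kappa j.+1) /t mulfVK ?subrr //.
by rewrite mulf_neq0 ?oppr_eq0 ?mulf_neq0 ?expf_neq0 // pnatr_eq0.
Qed.

End NonAiry.
End LocalSolutions.

(** * Determining factors *)

Lemma roots_of_power (C : numClosedFieldType) n (c : C) : (0 < n)%N -> c != 0 ->
  exists z : 'I_n -> C, injective z /\ forall y, (y ^+ n = c) <-> exists i, z i = y.
Proof.
move=> n0 c0; pose p : {poly C} := 'X^n - c%:P.
have sp : size p = n.+1 by rewrite size_XnsubC.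
have pm : lead_coef p = 1 by apply/eqP; exact: monicXnsubC.
have [s pE] := closed_field_poly_normal p; rewrite pm scale1r in pE.
have ss : size s = n by move: sp; rewrite pE size_prod_XsubC => -[].
have rootE y : (y ^+ n == c) = (y \in s).
  by rewrite -root_prod_XsubC -pE rootE !hornerE subr_eq0.
have us : uniq s.
  rewrite -separable_prod_XsubC -pE separable_poly.unlock derivB derivXn derivC subr0.
  rewrite -scaler_nat coprimepZr ?pnatr_eq0 -?lt0n // coprimep_expr //.
  have := coprimep_XsubC p 0; rewrite polyC0 subr0 => ->.
  by rewrite /root !hornerE expr0n gtn_eqF // sub0r oppr_eq0.
exists (fun i => s`_i); split=> [i j /eqP|y].
  by rewrite nth_uniq ?ss // => /eqP/val_inj.
split=> [/eqP|[i <-]]; last by apply/eqP; rewrite rootE mem_nth ?ss.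
rewrite rootE => ys; have iy : (index y s < n)%N by rewrite -ss index_mem.
by exists (Ordinal iy); rewrite nth_index.
Qed.

Section Airy.
Variable C : numClosedFieldType.
Variables (n q r m : nat) (a b : nat -> C).
Hypotheses (hn : (1 <= n)%N) (hq : (1 <= q)%N) (hr : (0 < r < n)%N)
  (hm : m = (q * n + r)%N) (an : a n = 1) (bm : b m != 0).
Implicit Types (g : C -> nat -> C) (W : {poly C}) (Q : puiseux C) (F : formal C).
Implicit Types (alpha : nat -> C) (e E M : nat).

Let m0 : (0 < m)%N. Proof. by rewrite hm; nia. Qed.

Definition airy_exponent Q := exists alpha,
  [/\ alpha_support n q m alpha, system_B n q m a b alpha & Q = airy_Q n q m alpha].

(** The other terms have positive order because M > 0. *)
Lemma symbol_coef0 e M W : (0 < e)%N -> (m * e <= M)%N ->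
  (symbol n m a b e M W)`_0 = W`_0 ^+ n - (if M == (m * e)%N then b m else 0).
Proof.
move=> e0 mM; have M0 : (0 < M)%N by apply: leq_trans mM; rewrite muln_gt0 m0.
rewrite coefB !coef_sum !big_nat_recr //=.
rewrite !big_nat !big1 ?add0r.
- rewrite an scale1r subnn muln0 expr0 mul1r coef0_exp coefZ coefXn.
  congr (_ - _); rewrite eq_sym subn_eq0 (_ : (M * n <= m * (n * e))%N = (M == m * e)%N).
    by case: eqP; rewrite ?mulr1 ?mulr0.
  by rewrite mulnCA mulnC leq_pmul2l // eqn_leq mM andbT.
- move=> j /andP[_ jm]; rewrite coefZ coefXn eq_sym subn_eq0 leqNgt.
  rewrite (_ : (j * (n * e) < M * n)%N) ?mulr0 //.
  apply: (@leq_trans (m * e * n)); last by rewrite leq_pmul2r.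
  by rewrite -mulnA [(e * n)%N]mulnC ltn_pmul2r // muln_gt0 hn.
- move=> i /andP[_ i_lt]; rewrite coefZ coefXnM (_ : (0 < M * (n - i))%N) ?mulr0 //.
  by rewrite muln_gt0 M0 subn_gt0.
Qed.

Lemma symbol_root_uniq e W1 W2 : (0 < e)%N ->
    'X^(m * e + n * e) %| symbol n m a b e (m * e) W1 ->
    'X^(m * e + n * e) %| symbol n m a b e (m * e) W2 ->
    W1`_0 = W2`_0 -> W1`_0 != 0 ->
  exponential (m * e) (n * e) W1 = exponential (m * e) (n * e) W2.
Proof.
move=> e0 d1 d2 eW W10.
have me0 : (0 < m * e)%N by rewrite muln_gt0 m0.
have c1 := symbol_congr b hn hq hr hm W1 e0 an.
have c2 := symbol_congr b hn hq hr hm W2 e0 an.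
have dW : 'X^(m * e + n * e) %| W1 - W2.
  apply: (truncated_root_uniq (c := a n.-1) hn me0) => //.
  have := dvdp_sub (dvdp_sub d1 c1) (dvdp_sub d2 c2).
  by rewrite !subKr opprB addrA subrK.
apply: eq_bigr => j _; congr (mkmalgU _ (_ * _)).
by have /dvdXnP/(_ _ (ltn_ord j))/eqP := dW; rewrite coefB subr_eq0 => /eqP.
Qed.

Lemma system_B_pow alpha : system_B n q m a b alpha ->
  alpha 0%N ^+ n = (-1) ^+ n * b m.
Proof.
case=> /(_ 0%N isT) + _; rewrite mul0n subn0 /beta coef0_exp coef_poly.
by rewrite addn_gt0 m0.
Qed.

Lemma signed_bm_neq0 : (-1) ^+ n * b m != 0.
Proof. by rewrite mulf_neq0 ?signr_eq0. Qed.

(** The W attached to a solution of (B), in the variable z^(1/(ne)). *)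
Definition airy_slope alpha e : {poly C} := (- \poly_(i < m + n) alpha i) \Po 'X^e.

Lemma airy_slopeP alpha e : (0 < e)%N ->
    alpha_support n q m alpha -> system_B n q m a b alpha ->
  [/\ (size (airy_slope alpha e) <= m * e + n * e)%N,
      'X^(m * e + n * e) %| symbol n m a b e (m * e) (airy_slope alpha e),
      (airy_slope alpha e)`_0 = - alpha 0%N, alpha 0%N != 0
    & airy_Q n q m alpha = exponential (m * e) (n * e) (airy_slope alpha e)].
Proof.
move=> e0 supp sysB; rewrite -mulnDl; split.
- apply/leq_sizeP => j; rewrite coef_comp_poly_Xn //; case: ifP => // /dvdnP[s ->].
  by rewrite leq_pmul2r // mulnK // coefN coef_poly ltnNge => ->; rewrite oppr0.
- rewrite (symbol_comp_Xn _ _ _ _ _ e0).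
  have /dvdpP[P ->] := symbol_system_B hn hq hr hm an supp sysB.
  by rewrite rmorphM /= rmorphXn /= comp_polyX -exprM mulnC dvdp_mull.
- by rewrite coef_comp_poly_Xn // dvdn0 div0n coefN coef_poly addn_gt0 m0.
- by have := signed_bm_neq0; rewrite -(system_B_pow sysB) expf_eq0 hn.
- by rewrite exponential_comp_Xn // (airy_Q_exponential hn hq hr hm supp).
Qed.

(** If M were larger than m e, the term W^n would dominate the symbol; so
M = m e, and W is a truncated root, which is compared with the one obtained from
(B) with the same constant coefficient. *)
Lemma airy_exponent_of_solution e Q g : (0 < e)%N -> exp_factor (n * e) Q ->
    airyQ_sol n m a b Q g -> bounded_below (n * e)%:R^-1 g ->
    (exists mu k, g mu k != 0) ->
  airy_exponent Q.
Proof.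
move=> e0 eQ sol bb [mu [k gn0]]; have E0 : (0 < n * e)%N by rewrite muln_gt0 hn.
have [M [W [mM sW QE MW]]] := exp_factor_exponential (m * e) E0 eQ.
have S0 d : (d < M + n * e)%N -> (symbol n m a b e M W)`_d = 0.
  move=> d_lt; apply/eqP; apply: contraNT gn0 => Sd; apply/eqP.
  by move: sol; rewrite QE => /(symbol_obstruction hn e0 sW mM); apply=> //; exists d.
have M0 : (0 < M)%N by apply: leq_trans mM; rewrite muln_gt0 m0.
have := S0 0%N (ltn_addr _ M0); rewrite symbol_coef0 //.
have [ME|Mn] := eqVneq M (m * e)%N; last first.
  case: MW => [/eqP|W0]; first by rewrite (negPf Mn).
  by rewrite subr0 => /eqP; rewrite expf_eq0 (negPf W0) andbF.
move=> /subr0_eq Wn; rewrite ME in sW QE S0.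
have yn : (- W`_0) ^+ n = (-1) ^+ n * b m.
  by rewrite [LHS]exprNn Wn.
have [alpha [supp sysB alpha0]] := system_B_exists a hn hq hr hm bm yn.
have [_ dA A0 al0 AE] := airy_slopeP e0 supp sysB.
exists alpha; split=> //; rewrite QE AE; apply: symbol_root_uniq => //.
- exact/dvdXnP.
- by rewrite A0 alpha0 opprK.
- by rewrite -oppr_eq0 -alpha0.
Qed.

(** The factors are parametrized by the n-th roots alpha_0 of (-1)^n b_m, which can
be read off from the leading coefficient of Q. *)
Lemma airy_exponent_enum : exists Qs : 'I_n -> puiseux C,
  injective Qs /\ forall Q, (exists i, Qs i = Q) <-> airy_exponent Q.
Proof.
have [z [z_inj zP]] := roots_of_power hn signed_bm_neq0.
have /choice[al alP] i : exists alpha, [/\ alpha_support n q m alpha,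
    system_B n q m a b alpha & alpha 0%N = z i].
  by apply: (system_B_exists a hn hq hr hm bm); apply/(zP (z i)); exists i.
exists (fun i => airy_Q n q m (al i)); split=> [i j QE|Q].
  apply: z_inj; have [supi _ <-] := alP i; have [supj _ <-] := alP j.
  have := congr1 (fun Q : puiseux C => Q@_(- ((m + n)%:R / n%:R))) QE.
  rewrite (airy_Q_exponential hn hq hr hm supi) (airy_Q_exponential hn hq hr hm supj).
  rewrite !(mcoeff_exponential _ _ hn) !coefN !coef_poly addn_gt0 m0.
  have c0 : n%:R / (m + n)%:R != 0 :> C.
    by rewrite mulf_neq0 ?invr_eq0 ?pnatr_eq0 -?lt0n ?addn_gt0 ?m0.
  by move/(mulfI c0)/oppr_inj.
split=> [[i <-]|[alpha [supp sysB ->]]].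
  by have [? ? _] := alP i; exists (al i).
have [i zi] := (zP (alpha 0%N)).1 (system_B_pow sysB); exists i.
have [supi sysi ali0] := alP i.
have [_ d1 W1 n1 ->] := airy_slopeP (ltn0Sn 0) supi sysi.
have [_ d2 W2 n2 ->] := airy_slopeP (ltn0Sn 0) supp sysB.
by apply: symbol_root_uniq; rewrite // W1 ?oppr_eq0 // W2 ali0 zi.
Qed.

Lemma airyQ0 Q mu k : airyQ n m a b Q (fun _ _ => 0) mu k = 0.
Proof.
have -> : (fun _ _ => 0) = comb (-1) (fun _ _ => 0) (fun _ _ => 0) :> (C -> nat -> C).
  by apply/funext => x; apply/funext => l; rewrite /comb mulr0 addr0.
by rewrite airyQ_comb mulN1r subrr.
Qed.

Lemma airy_exponent_solution Q : airy_exponent Q -> exists F : formal C,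
  [/\ ht_expr n Q F, airy_sol n m a b F & exists mu k, F Q mu k != 0].
Proof.
case=> alpha [supp sysB QE].
have [] := airy_slopeP (ltn0Sn 0) supp sysB.
set W := airy_slope _ _ => sW dS W0 al0 QW.
have Wn0 : W`_0 != 0 by rewrite W0 oppr_eq0.
have M0 : (0 < m * 1)%N by rewrite muln1.
have S0 := elimT (dvdXnP _ _) dS.
have sol := series_at_sol hn (ltn0Sn 0) sW (leqnn _) an M0 Wn0 S0.
pose rho := indicial_root n m 1 (m * 1) a b W.
pose s := series_coef n m 1 (m * 1) a b W.
have s0 : s 0%N = 1 by [].
pose F : formal C := fun Q' mu k => if Q' == Q then series_at n 1 rho s mu k else 0.
have FQ : F Q = series_at n 1 rho s.
  by apply/funext => mu; apply/funext => k; rewrite /F eqxx.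
have atE := series_atE hn (ltn0Sn 0) rho s; rewrite muln1 in atE.
have out := @series_at_out C n 1 rho s; rewrite muln1 in out.
exists F; split.
- split=> //.
    by rewrite QE QW !muln1; apply: exponential_exp_factor.
  exists rho, [:: s]; split=> [k j|Q' mu k [QQ'|out']].
  + by rewrite FQ atE; case: k => //= k; rewrite nth_nil.
  + by rewrite /F; case: eqP.
  + by rewrite /F; case: eqP => // _; apply: out.
- move=> Q' mu k; rewrite airy_op_component /F; case: eqP => [->|_]; last exact: airyQ0.
  by rewrite QE QW; apply: sol.
- by exists (rho + 0%:R / n%:R), 0%N; rewrite FQ atE /= s0 oner_eq0.
Qed.

(** If some mu - j0/E is an exponent lambda + i0/e of the expansion, then mu - j/E
lies below lambda once j > j0 + i0 E/e. *)
Lemma ht_expr_component e E Q F : (0 < E)%N -> (e %| E)%N -> ht_expr e Q F ->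
  forall Q', [/\ bounded_below E%:R^-1 (F Q'), log_finite (F Q')
             & Q' <> Q -> forall mu k, F Q' mu k = 0].
Proof.
move=> E0 /dvdnP[d Ed] [e0 _ [lam [v [Fv F0]]]] Q'.
have d0 : (0 < d)%N by move: E0; rewrite Ed muln_gt0 => /andP[].
have h0 : E%:R^-1 != 0 :> C by rewrite invr_eq0 pnatr_eq0 -lt0n.
have invE (i : nat) : i%:R / e%:R = (i * d)%:R * E%:R^-1 :> C.
  by rewrite Ed !natrM invfM mulrA mulfK // pnatr_eq0 -lt0n.
split.
- move=> mu; have [[j0 [i0 muE]]|no] := pselect (exists j0 i0 : nat,
      mu - j0%:R * E%:R^-1 = lam + i0%:R / e%:R).
    exists (j0 + i0 * d).+1 => j k j_gt; apply: F0; right=> i; rewrite !invE in muE *.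
    move=> muE'; suff : (j + i * d)%:R * E%:R^-1 = (j0 + i0 * d)%:R * E%:R^-1 :> C.
      by move/(mulIf h0)/eqP; rewrite eqr_nat; lia.
    have aux J I : mu - J = lam + I -> J + I = mu - lam.
      by move=> JI; rewrite -[mu](subrK J) JI; ring.
    by rewrite !natrD !mulrDl (aux _ _ muE) (aux _ _ muE').
  exists 0%N => j k _; apply: F0; right=> i muE; apply: no.
  by exists j, i.
- exists (size v) => mu k vk.
  have [[QE [j ->]]|no] := pselect (Q' = Q /\ exists j : nat, mu = lam + j%:R / e%:R).
    by rewrite QE Fv nth_default.
  apply: F0; have [QE|] := pselect (Q' = Q); [right=> j muE|by left].
  by apply: no; split=> //; exists j.
- by move=> QQ' mu k; apply: F0; left.
Qed.

Lemma exp_factor_mul e d Q : (0 < e)%N -> (0 < d)%N ->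
  exp_factor e Q -> exp_factor (e * d) Q.
Proof.
move=> e0 d0 eQ; have [M [W [_ _ -> _]]] := exp_factor_exponential 0 e0 eQ.
rewrite -(exponential_comp_Xn _ _ d0 e0); exact: exponential_exp_factor.
Qed.

(** A common denominator for the finitely many expressions puts all of them on the
same lattice of exponents. *)
Lemma ht_sum_component F : ht_sum F -> exists2 e, (0 < e)%N &
  forall Q, [/\ bounded_below (n * e)%:R^-1 (F Q), log_finite (F Q)
           & (exists mu k, F Q mu k != 0) -> exp_factor (n * e) Q].
Proof.
move=> [N [f [fP FE]]].
have /choice[ei eiP] i := fP i.
have ei0 i : (0 < ei i)%N by have [? []] := eiP i.
have E0 : (0 < \prod_i ei i)%N by rewrite prodn_gt0.
exists (\prod_i ei i)%N => // Q; set E := (n * _)%N.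
have EE0 : (0 < E)%N by rewrite muln_gt0 hn.
have comp i : [/\ bounded_below E%:R^-1 (f i Q), log_finite (f i Q)
             & (exists mu k, f i Q mu k != 0) -> exp_factor E Q].
  have [Qi fQi] := eiP i.
  have dE : (ei i %| E)%N by rewrite dvdn_mull // (bigD1 i) //= dvdn_mulr.
  have [bb lf out] := ht_expr_component EE0 dE fQi Q; split=> // -[mu [k fn0]].
  have QE : Q = Qi by apply: contrapT => /out/(_ mu k) f0; rewrite f0 eqxx in fn0.
  have [_ efi _] := fQi; rewrite QE; have /dvdnP[d Ed] := dE; rewrite Ed mulnC.
  apply: exp_factor_mul => //; rewrite lt0n; apply: contraTneq EE0 => d0.
  by rewrite Ed d0.
have FQ : F Q = fun mu k => \sum_i f i Q mu k by apply/funext => mu; apply/funext => k.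
have both : bounded_below E%:R^-1 (F Q) /\ log_finite (F Q).
  rewrite FQ; elim: (index_enum _) => [|i s [IHb IHl]].
    split; first by move=> mu; exists 0%N => j k _; rewrite big_nil.
    by exists 0%N => mu k _; rewrite big_nil.
  have -> : (fun mu k => \sum_(j <- i :: s) f j Q mu k) =
      comb 1 (f i Q) (fun mu k => \sum_(j <- s) f j Q mu k).
    by apply/funext => mu; apply/funext => k; rewrite big_cons /comb mul1r.
  have [bi li _] := comp i.
  by split; [apply: bounded_below_comb|apply: log_finite_comb].
case: both => bb lf; split=> // -[mu [k]]; rewrite FE => Fn0.
have [i fi] : exists i, f i Q mu k != 0.
  apply: contrapT => no; case/negP: Fn0; rewrite big1 // => i _; apply/eqP.
  by apply: contrapT => /negP fi; apply: no; exists i.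
by have [_ _] := comp i; apply; exists mu, k.
Qed.

(** Solutions with distinct factors are independent.  The component of any solution
along an admissible factor is a multiple of the solution attached to it, and its
other components vanish. *)
Lemma ht_basis_of_enum (Qs : 'I_n -> puiseux C) : injective Qs ->
  (forall Q, (exists i, Qs i = Q) <-> airy_exponent Q) ->
  determining_factors m a b Qs.
Proof.
move=> Qinj QsP.
have /choice[u uP] i : exists F : formal C,
    [/\ ht_expr n (Qs i) F, airy_sol n m a b F & exists mu k, F (Qs i) mu k != 0].
  by apply: airy_exponent_solution; apply/QsP; exists i.
have uht i : ht_expr n (Qs i) (u i) by have [] := uP i.
have usol i : airy_sol n m a b (u i) by have [] := uP i.
have un0 i : exists mu k, u i (Qs i) mu k != 0 by have [] := uP i.
have uout i Q mu k : Q <> Qs i -> u i Q mu k = 0.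
  by move=> QQ; have [_ _ [lam [v [_ ->]]]] := uht i => //; left.
have ucoll c i mu k : \sum_j c j * u j (Qs i) mu k = c i * u i (Qs i) mu k.
  rewrite (bigD1 i) //= big1 ?addr0 // => j ji.
  by rewrite uout ?mulr0 // => /Qinj ij; rewrite ij eqxx in ji.
exists u; split=> //; first by exists n.
  move=> c c0 i; have [mu [k un]] := un0 i; apply/eqP.
  by have /eqP := c0 (Qs i) mu k; rewrite ucoll mulf_eq0 (negPf un) orbF.
move=> F Fht Fsol; have [e e0 FP] := ht_sum_component Fht.
have E0 : (0 < n * e)%N by rewrite muln_gt0 hn.
have Fsol' Q : airyQ_sol n m a b Q (F Q).
  by move=> mu k; rewrite -airy_op_component; apply: Fsol.
have /choice[c cP] i : exists c, forall mu k, F (Qs i) mu k = c * u i (Qs i) mu k.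
  have [alpha [supp sysB QE]] := (QsP (Qs i)).1 (ex_intro _ i erefl).
  have [sW dS W0 al0 QW] := airy_slopeP e0 supp sysB.
  have Wn0 : (airy_slope alpha e)`_0 != 0 by rewrite W0 oppr_eq0.
  have me0 : (0 < m * e)%N by rewrite muln_gt0 m0.
  have S0 := elimT (dvdXnP _ _) dS.
  have [Fbb Flf _] := FP (Qs i).
  have [ubb ulf _] := ht_expr_component E0 (dvdn_mulr _ (dvdnn n)) (uht i) (Qs i).
  apply: (solutions_proportional hn e0 sW (leqnn _) an me0 Wn0 S0) => //.
    by rewrite -QW -QE; apply: Fsol'.
  by rewrite -QW -QE => mu k; rewrite -airy_op_component; apply: usol.
exists c => Q mu k; have [[i <-]|no] := pselect (exists i, Qs i = Q).
  by rewrite ucoll cP.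
rewrite big1 => [|i _]; last first.
  by rewrite uout ?mulr0 // => QE; apply: no; exists i.
apply: contrapT => /eqP Fn0; apply/no/QsP; have [bb _ ef] := FP Q.
apply: (airy_exponent_of_solution e0 _ (Fsol' Q) bb); last by exists mu, k.
by apply: ef; exists mu, k.
Qed.

(** Each basis element is a nonzero solution with factor Q_i, so Q_i comes from
(B).  Conversely the solution attached to an admissible Q is a combination of
the basis, some member of which must have the factor Q. *)
Lemma determining_factors_range (Qs : 'I_n -> puiseux C) Q :
  determining_factors m a b Qs -> (exists i, Qs i = Q) <-> airy_exponent Q.
Proof.
move=> [u [[e eP] usol ufree uspan]]; split=> [[i <-]|Qairy].
  have [e0 efi _] := eP i; have ne0 : (0 < n * e)%N by rewrite muln_gt0 hn.
  have [bb lf out] := ht_expr_component ne0 (dvdn_mull _ (dvdnn e)) (eP i) (Qs i).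
  apply: (@airy_exponent_of_solution e _ (u i (Qs i))) => //.
  - by rewrite mulnC; apply: exp_factor_mul.
  - by move=> mu k; rewrite -airy_op_component; apply: usol.
  apply: contrapT => no.
  suff z Q' mu k : \sum_j (j == i)%:R * u j Q' mu k = 0.
    have /eqP := ufree (fun j => (j == i)%:R) z i.
    by rewrite eqxx oner_eq0.
  rewrite (bigD1 i) //= big1 ?addr0 => [|j /negPf->]; last by rewrite mul0r.
  rewrite eqxx mul1r; have [->|QQ] := pselect (Q' = Qs i).
    by apply: contrapT => /eqP un0; apply: no; exists mu, k.
  by have [_ _ ->] := ht_expr_component ne0 (dvdn_mull _ (dvdnn e)) (eP i) Q'.
have [F [Fht Fsol [mu [k Fn0]]]] := airy_exponent_solution Qairy.
have [|c cP] := uspan F _ Fsol.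
  exists 1%N, (fun=> F); split=> [_|Q' mu' k']; last by rewrite big_ord1.
  by exists n, Q.
apply: contrapT => no; move: Fn0; rewrite cP big1 ?eqxx // => i _.
have [_ _ [lam [v [_ ->]]]] := eP i; first exact: mulr0.
by left=> QE; apply: no; exists i.
Qed.

(** The range of Q_1, ..., Q_n has n elements, so surjectivity onto it forces
injectivity. *)
Lemma determining_factorsE (Qs : 'I_n -> puiseux C) :
  determining_factors m a b Qs <->
  injective Qs /\ forall Q, (exists i, Qs i = Q) <-> airy_exponent Q.
Proof.
split=> [detQs|[Qinj QsP]]; last exact: ht_basis_of_enum.
have QsP Q := determining_factors_range Q detQs; split=> //.
have [Qs0 [Qs0_inj Qs0P]] := airy_exponent_enum.
have /choice[s sP] i : exists j, Qs j = Qs0 i.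
  by apply/QsP; apply/Qs0P; exists i.
have s_inj : injective s by move=> i j sij; apply: Qs0_inj; rewrite -!sP sij.
have [t st ts] := injF_bij s_inj.
by move=> i j; rewrite -(ts i) -(ts j) !sP => /Qs0_inj ->.
Qed.

End Airy.

Lemma airy_exponent_eq (C : numClosedFieldType) n q m (a b a' b' : nat -> C) Q :
  a' n.-1 = a n.-1 -> (forall s, (s <= q.+1)%N -> b' (m - s)%N = b (m - s)%N) ->
  airy_exponent n q m a' b' Q <-> airy_exponent n q m a b Q.
Proof.
move=> ea eb; split=> -[alpha [supp [h1 h2] QE]]; exists alpha; split=> //; split=> //.
- by move=> s hs; rewrite h1 // eb.
- by rewrite h2 ea.
- by move=> s hs; rewrite h1 // eb.
- by rewrite h2 ea.
Qed.

Theorem proposition1p2p3 (R : realType) (n q r m : nat) (a b : nat -> R[i])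
    (hn : (1 <= n)%N) (hq : (1 <= q)%N) (hr : (0 < r < n)%N)
    (hm : m = (q * n + r)%N) (ha : a n = 1) (hb : b m != 0) :
  [/\ exists Qs : 'I_n -> puiseux R[i], determining_factors m a b Qs,
      forall Qs : 'I_n -> puiseux R[i], determining_factors m a b Qs ->
        forall Q : puiseux R[i],
          (exists i, Qs i = Q) <->
          (exists alpha : nat -> R[i],
             [/\ alpha_support n q m alpha, system_B n q m a b alpha
               & Q = airy_Q n q m alpha]) &
      forall a' b' : nat -> R[i],
        a' n = 1 -> b' m != 0 ->
        a' n.-1 = a n.-1 ->
        (forall s : nat, (s <= q.+1)%N -> b' (m - s)%N = b (m - s)%N) ->
        forall Qs : 'I_n -> puiseux R[i],
          determining_factors m a' b' Qs <-> determining_factors m a b Qs].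
Proof.
split.
- have [Qs [Qinj QsP]] := airy_exponent_enum hn hq hr hm ha hb.
  by exists Qs; apply: (ht_basis_of_enum hn hq hr hm ha hb).
- move=> Qs detQs Q; exact: (determining_factors_range hn hq hr hm ha hb).
move=> a' b' ha' hb' ea eb Qs.
rewrite !(determining_factorsE hn hq hr hm) //.
have eqv Q := airy_exponent_eq Q ea eb.
split=> -[Qinj QsP]; split=> // Q; first exact: iff_trans (QsP Q) (eqv Q).
exact: iff_trans (QsP Q) (iff_sym (eqv Q)).
Qed.
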